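(* Let $\mu\in(0,1)$, let $N\ge2$ and $\nu\ge0$ be integers, and write $\alpha=\frac{1+\mu}{2\mu}$, $\delta=\frac{1-\mu}{2\mu}$. With $P_n$, $Q_n$, $K_N$ as defined in the context, for all $x,y>0$ with $x\neq y$, $$K_N(x,y)=-\frac{a_{-2,N}P_{N-2}(x)Q_N(y)+a_{-2,N+1}P_{N-1}(x)Q_{N+1}(y)+a_{-1,N}P_{N-1}(x)Q_N(y)}{x-y}$$ $$\qquad+\frac{a_{1,N-1}P_N(x)Q_{N-1}(y)+a_{2,N-2}P_N(x)Q_{N-2}(y)+a_{2,N-1}P_{N+1}(x)Q_{N-1}(y)}{x-y},$$ where $$a_{2,n}=\frac{1}{(n+2)(n+1)}\frac{\delta^2}{(\alpha^2-\delta^2)^2},\qquad a_{1,n}=\frac{1}{\alpha^2-\delta^2}+\frac{2(2n+\nu+2)}{n+1}\frac{\delta^2}{(\alpha^2-\delta^2)^2},$$ $$a_{-1,n}=\frac{n^2(n+\nu)(3n+\nu)}{\alpha^2-\delta^2}+2n^2(\nu+n)(2n+\nu)\frac{\delta^2}{(\alpha^2-\delta^2)^2},$$ $$a_{-2,n}=(\nu+n)(\nu+n-1)n^2(n-1)^2\frac{\alpha^2}{(\alpha^2-\delta^2)^2}.$$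
   Context: $I_\kappa$ and $K_\kappa$ are the modified Bessel functions of the first and second kind; $(a)_k=a(a+1)\cdots(a+k-1)$ is the Pochhammer symbol. For $n=0,1,\ldots$, $$P_n(x)=(-1)^n(\nu+n)!\,n!\sum_{k=0}^n\frac{(\alpha^2-\delta^2)^{k+\frac12}}{\delta^k}\frac{(-n)_k}{(\nu+k)!\,k!}\,x^{\frac k2}I_k(2\delta\sqrt x),$$ $$Q_n(y)=(-1)^n\frac{2}{(n!)^2}\sum_{l=0}^n\frac{(\alpha^2-\delta^2)^{l+\nu+\frac12}}{\alpha^{l+\nu}}\frac{(-n)_l}{(\nu+l)!\,l!}\,y^{\frac{l+\nu}2}K_{l+\nu}(2\alpha\sqrt y),$$ and $K_N(x,y)=\sum_{n=0}^{N-1}P_n(x)Q_n(y)$ (the correlation kernel of the squared singular values of $X_1X_2$, where $X_1$, $X_2$ are $N\times M$ and $M\times N$ random matrices, $M=N+\nu$, with joint density $(\pi^2\mu)^{-NM}\exp[-\alpha\operatorname{Tr}(X_1X_1^*+X_2^*X_2)+\delta\operatorname{Tr}(X_1X_2+X_2^*X_1^* )]$). *)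

(* Defs.v *)
From Stdlib Require Import Reals Factorial.
From Coquelicot Require Import Coquelicot.

Open Scope R_scope.

Fixpoint pochhammer (a : R) (k : nat) : R :=
  match k with
  | O => 1
  | S k' => pochhammer a k' * (a + INR k')
  end.

(* Modified Bessel function of the first kind of order k. Only nonnegative
   integer orders are needed, so Gamma (m + k + 1) is written (m + k)!. *)
Definition besselI (k : nat) (z : R) : R :=
  Series (fun m : nat =>
    (z / 2) ^ (2 * m + k) / (INR (fact m) * INR (fact (m + k)))).

(* Modified Bessel function of the second kind of real order kappa, for z > 0,
   by its integral over [0, +oo[ (Abramowitz-Stegun 9.6.24, DLMF 10.32.9). *)
Definition besselK (kappa z : R) : R :=
  RInt_gen (fun t : R => exp (- z * cosh t) * cosh (kappa * t))
    (at_point 0) (Rbar_locally p_infty).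

(* In P, Q and kernelK, sum_f_R0 f n is f 0 + ... + f n (n + 1 terms), and
   Rpower is the real power of a positive base. *)
Definition P (alpha delta : R) (nu n : nat) (x : R) : R :=
  (-1) ^ n * INR (fact (nu + n)) * INR (fact n) *
  sum_f_R0 (fun k : nat =>
    Rpower (alpha ^ 2 - delta ^ 2) (INR k + 1 / 2) / delta ^ k
    * (pochhammer (- INR n) k / (INR (fact (nu + k)) * INR (fact k)))
    * Rpower x (INR k / 2) * besselI k (2 * delta * sqrt x)) n.

Definition Q (alpha delta : R) (nu n : nat) (y : R) : R :=
  (-1) ^ n * (2 / INR (fact n) ^ 2) *
  sum_f_R0 (fun l : nat =>
    Rpower (alpha ^ 2 - delta ^ 2) (INR l + INR nu + 1 / 2) / alpha ^ (l + nu)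
    * (pochhammer (- INR n) l / (INR (fact (nu + l)) * INR (fact l)))
    * Rpower y (INR (l + nu) / 2)
    * besselK (INR (l + nu)) (2 * alpha * sqrt y)) n.

(* Sum over 0 <= n <= N - 1; meaningful for N >= 1 only. *)
Definition kernelK (alpha delta : R) (nu N : nat) (x y : R) : R :=
  sum_f_R0 (fun n : nat => P alpha delta nu n x * Q alpha delta nu n y) (N - 1).

(* The coefficients a_{2,n}, a_{1,n}, a_{-1,n}, a_{-2,n}; all arithmetic on the
   indices is done in R, so there is no truncated subtraction. *)
Definition a_2 (alpha delta : R) (n : nat) : R :=
  1 / ((INR n + 2) * (INR n + 1)) * (delta ^ 2 / (alpha ^ 2 - delta ^ 2) ^ 2).

Definition a_1 (alpha delta : R) (nu n : nat) : R :=
  1 / (alpha ^ 2 - delta ^ 2)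
  + 2 * (2 * INR n + INR nu + 2) / (INR n + 1)
    * (delta ^ 2 / (alpha ^ 2 - delta ^ 2) ^ 2).

Definition a_m1 (alpha delta : R) (nu n : nat) : R :=
  INR n ^ 2 * (INR n + INR nu) * (3 * INR n + INR nu) / (alpha ^ 2 - delta ^ 2)
  + 2 * INR n ^ 2 * (INR nu + INR n) * (2 * INR n + INR nu)
    * (delta ^ 2 / (alpha ^ 2 - delta ^ 2) ^ 2).

Definition a_m2 (alpha delta : R) (nu n : nat) : R :=
  (INR nu + INR n) * (INR nu + INR n - 1) * INR n ^ 2 * (INR n - 1) ^ 2
  * (alpha ^ 2 / (alpha ^ 2 - delta ^ 2) ^ 2).

(* Main.v *)
Require Import Defs.
From Stdlib Require Import Reals Lra Lia Factorial.
From Coquelicot Require Import Coquelicot.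

Open Scope R_scope.

(* With c = alpha^2 - delta^2, both P_n(x) and Q_n(y) are, up to a factor depending
   on n only, n-th binomial differences sum_k (-1)^k C(n, k) phi_k of a sequence phi
   built from Bessel functions.  The recurrence of I_k (from its series) and that of
   K_l (by parts in its integral) make multiplication by the variable act on phi as
     x phi_k = A (nu+k+2)(nu+k+1) phi_{k+2} + B (nu+k+1)(k+1+tau) phi_{k+1},
   with (A, B, tau) = (delta^2/c^2, 1/c, 0) for P and (alpha^2/c^2, -1/c, nu) for Q.
   On binomial differences, multiplication by a degree 2 polynomial in k combines the
   indices n, n - 1, n - 2, and a shift of k by at most 2 the indices n, n + 1, n + 2:
   this yields five-term recurrences for P_n and Q_n which are transposes of each other,
   so (x - y) P_n(x) Q_n(y) telescopes as in the Christoffel-Darboux formula. *)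

(** * Binomial differences *)

(** This is (-1)^k C(a, k). A real [a] allows the shifts a + 1, a - 1, a - 2 with no truncated
    subtraction. *)
Definition signed_binom (a : R) (k : nat) : R := pochhammer (- a) k / INR (fact k).

(** The value 0 at index 0 lets a sum against phi_{k+1} be reindexed as a sum against phi_j still
    starting at 0. *)
Definition shift1 (u : nat -> R) (j : nat) : R :=
  match j with O => 0 | S i => u i end.

Lemma signed_binom_rec (a : R) (k : nat) :
  INR (S k) * signed_binom a (S k) = (INR k - a) * signed_binom a k.
Proof.
  unfold signed_binom; cbn [pochhammer].
  rewrite fact_simpl, mult_INR.
  pose proof (INR_fact_neq_0 k); pose proof (not_0_INR (S k) (Nat.neq_succ_0 k)).
  field; split; assumption.
Qed.

(** Pascal's rule with signs. As [a] is real, it is derived from the ratio of consecutive terms in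
    [signed_binom_rec]. *)
Lemma signed_binom_pascal_S (a : R) (k : nat) :
  signed_binom (a + 1) (S k) = signed_binom a (S k) - signed_binom a k.
Proof.
  induction k as [|k IH].
  - unfold signed_binom; simpl; field.
  - assert (Hk : INR (S (S k)) <> 0) by (apply not_0_INR; lia).
    apply (Rmult_eq_reg_l (INR (S (S k)))); [|exact Hk].
    rewrite Rmult_minus_distr_l, !signed_binom_rec, IH.
    pose proof (signed_binom_rec a k) as E.
    rewrite !S_INR in *. lra.
Qed.

Lemma signed_binom_pascal (a : R) (j : nat) :
  shift1 (signed_binom a) j = signed_binom a j - signed_binom (a + 1) j.
Proof.
  destruct j as [|j]; cbn [shift1].
  - unfold signed_binom; simpl; field.
  - rewrite signed_binom_pascal_S; ring.
Qed.

(** Absorption j C(a, j) = a C(a - 1, j - 1), after which Pascal's rule at a - 1 removes the shift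
    in j. *)
Lemma signed_binom_absorb (a : R) (j : nat) :
  INR j * signed_binom a j = a * (signed_binom a j - signed_binom (a - 1) j).
Proof.
  pose proof (signed_binom_pascal (a - 1) j) as E.
  replace (a - 1 + 1) with a in E by ring.
  replace (signed_binom a j - signed_binom (a - 1) j)
    with (- shift1 (signed_binom (a - 1)) j) by lra.
  clear E.
  destruct j as [|j]; [simpl; ring|]. cbn [shift1].
  unfold signed_binom.
  (* [pochhammer] appends its last factor; here the first one, -a, is pulled out. *)
  assert (Hp : forall k, pochhammer (- a) (S k) = - a * pochhammer (- (a - 1)) k).
  { induction k as [|k IH]; [simpl; ring|].
    change (pochhammer (- a) (S k) * (- a + INR (S k)) =
      - a * (pochhammer (- (a - 1)) k * (- (a - 1) + INR k))).
    rewrite IH, S_INR; ring. }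
  rewrite Hp, fact_simpl, mult_INR.
  pose proof (INR_fact_neq_0 j); pose proof (not_0_INR (S j) (Nat.neq_succ_0 j)).
  field; split; assumption.
Qed.

Lemma signed_binom_absorb2 (a : R) (j : nat) :
  INR j ^ 2 * signed_binom a j =
  a * (a * (signed_binom a j - signed_binom (a - 1) j)
       - (a - 1) * (signed_binom (a - 1) j - signed_binom (a - 2) j)).
Proof.
  pose proof (signed_binom_absorb a j) as E1.
  pose proof (signed_binom_absorb (a - 1) j) as E2.
  replace (a - 1 - 1) with (a - 2) in E2 by ring.
  replace (INR j ^ 2 * signed_binom a j) with (INR j * (INR j * signed_binom a j)) by ring.
  rewrite E1.
  replace (INR j * (a * (signed_binom a j - signed_binom (a - 1) j)))
    with (a * (INR j * signed_binom a j - INR j * signed_binom (a - 1) j)) by ring.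
  rewrite E1, E2; ring.
Qed.

(** The factor -n + n occurs in the Pochhammer symbol. Hence binomial sums of different orders can
    share one upper bound. *)
Lemma signed_binom_vanish (n k : nat) : (n < k)%nat -> signed_binom (INR n) k = 0.
Proof.
  intros H; unfold signed_binom.
  enough (E : pochhammer (- INR n) k = 0) by (rewrite E; unfold Rdiv; ring).
  induction H as [|k H IH]; cbn [pochhammer].
  - ring.
  - rewrite IH; ring.
Qed.

(** Up to the sign (-1)^n, the n-th forward difference of [phi] at 0. *)
Definition binom_sum (phi : nat -> R) (n : nat) : R :=
  sum_f_R0 (fun k => signed_binom (INR n) k * phi k) n.

Lemma binom_sum_extend (phi : nat -> R) (n m : nat) : (n <= m)%nat ->
  sum_f_R0 (fun k => signed_binom (INR n) k * phi k) m = binom_sum phi n.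
Proof.
  intros H; induction H as [|m H IH]; [reflexivity|].
  cbn [sum_f_R0]. rewrite IH, signed_binom_vanish by lia. ring.
Qed.

Lemma sum_shift1 (u v : nat -> R) (m : nat) :
  sum_f_R0 (fun k => u k * v (S k)) m = sum_f_R0 (fun k => shift1 u k * v k) (S m).
Proof.
  induction m as [|m IH]; [simpl; ring|].
  rewrite (tech5 _ (S m)), <- IH. reflexivity.
Qed.

Lemma sum_scal_l (u : nat -> R) (c : R) (m : nat) :
  sum_f_R0 (fun k => c * u k) m = c * sum_f_R0 u m.
Proof. rewrite scal_sum; apply sum_eq; intros; ring. Qed.

(* The coefficients of the operator
     A (nu + j)(nu + j - 1)(E - 1)^2 + B (nu + j)(j + tau)(1 - E),   E : a |-> a + 1,
   once [signed_binom_absorb] has turned the factors j into shifts of a. *)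
Definition up2 (A nu a : R) : R := A * (nu + a + 2) * (nu + a + 1).
Definition up1 (A B tau nu a : R) : R :=
  - (nu + a + 1) * (2 * A * (nu + 2 * a + 2) + B * (a + 1 + tau)).
Definition diag (A B tau nu a : R) : R :=
  A * ((a + 1) * (5 * a + 4 * nu + 2) + (nu + a) * (nu + a - 1))
  + B * ((nu + a) * (a + tau) + (a + 1) * (nu + tau + 2 * a + 1)).
Definition down1 (A B tau nu a : R) : R :=
  - a * (2 * A * (2 * a + nu) + B * (3 * a + nu + tau)).
Definition down2 (A B a : R) : R := (A + B) * (a * (a - 1)).

(** Pascal's rule turns one or two shifts of j into first or second differences in a, reaching a +
    2; absorbing up to two factors j then lowers a by at most 2. *)
Lemma signed_binom_five_term (A B tau nu a : R) (j : nat) :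
  A * (nu + INR j) * (nu + INR j - 1) * shift1 (shift1 (signed_binom a)) j
  + B * (nu + INR j) * (INR j + tau) * shift1 (signed_binom a) j =
  up2 A nu a * signed_binom (a + 2) j
  + up1 A B tau nu a * signed_binom (a + 1) j
  + diag A B tau nu a * signed_binom a j
  + down1 A B tau nu a * signed_binom (a - 1) j
  + down2 A B a * signed_binom (a - 2) j.
Proof.
  assert (Hsh : shift1 (shift1 (signed_binom a)) j
    = signed_binom (a + 2) j - 2 * signed_binom (a + 1) j + signed_binom a j).
  { pose proof (signed_binom_pascal a j) as E.
    pose proof (signed_binom_pascal (a + 1) j) as E'.
    replace (a + 1 + 1) with (a + 2) in E' by ring.
    replace (shift1 (shift1 (signed_binom a)) j)
      with (shift1 (signed_binom a) j - shift1 (signed_binom (a + 1)) j); [lra|].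
    destruct j as [|j]; cbn [shift1]; [ring|].
    pose proof (signed_binom_pascal a j). lra. }
  rewrite Hsh, signed_binom_pascal.
  pose proof (signed_binom_absorb (a + 2) j) as E2.
  pose proof (signed_binom_absorb (a + 1) j) as E1.
  pose proof (signed_binom_absorb a j) as E0.
  pose proof (signed_binom_absorb2 (a + 2) j) as F2.
  pose proof (signed_binom_absorb2 (a + 1) j) as F1.
  pose proof (signed_binom_absorb2 a j) as F0.
  replace (a + 2 - 1) with (a + 1) in * by ring.
  replace (a + 2 - 2) with a in * by ring.
  replace (a + 1 - 1) with a in * by ring.
  replace (a + 1 - 2) with (a - 1) in * by ring.
  set (w2 := signed_binom (a + 2) j) in *. set (w1 := signed_binom (a + 1) j) in *.
  set (w0 := signed_binom a j) in *.
  (* The coefficients are expanded in powers of j, so that each j w and j^2 w matches an absorption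
     identity. *)
  transitivity
    (A * (nu * (nu - 1) * w2 + (2 * nu - 1) * (INR j * w2) + INR j ^ 2 * w2)
     + (-2 * A) * (nu * (nu - 1) * w1 + (2 * nu - 1) * (INR j * w1) + INR j ^ 2 * w1)
     + A * (nu * (nu - 1) * w0 + (2 * nu - 1) * (INR j * w0) + INR j ^ 2 * w0)
     + B * (nu * tau * w0 + (nu + tau) * (INR j * w0) + INR j ^ 2 * w0)
     - B * (nu * tau * w1 + (nu + tau) * (INR j * w1) + INR j ^ 2 * w1)).
  - ring.
  - rewrite E2, E1, E0, F2, F1, F0. unfold up2, up1, diag, down1, down2. ring.
Qed.

(* The truncated [n - 1] and [n - 2] are harmless: their coefficients vanish for
   n = 0 and n <= 1 respectively. *)
Lemma binom_sum_five_term (x A B tau : R) (nu n : nat) (phi : nat -> R) :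
  (forall k, x * phi k =
     A * (INR nu + INR k + 2) * (INR nu + INR k + 1) * phi (S (S k))
     + B * (INR nu + INR k + 1) * (INR k + 1 + tau) * phi (S k)) ->
  x * binom_sum phi n =
  up2 A (INR nu) (INR n) * binom_sum phi (n + 2)
  + up1 A B tau (INR nu) (INR n) * binom_sum phi (n + 1)
  + diag A B tau (INR nu) (INR n) * binom_sum phi n
  + down1 A B tau (INR nu) (INR n) * binom_sum phi (n - 1)
  + down2 A B (INR n) * binom_sum phi (n - 2).
Proof.
  intros Hphi.
  set (v := INR nu) in *. set (a := INR n).
  set (w := fun b k => signed_binom b k * phi k).
  (* All five binomial sums are brought to the common range 0, ..., n + 2. *)
  assert (Hdown : forall c i, (i <= n)%nat -> 
    c * binom_sum phi (n - i) = c * sum_f_R0 (w (a - INR i)) (S (S n))).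
  { intros c i Hi. unfold w, a. rewrite <- minus_INR by exact Hi.
    rewrite binom_sum_extend by lia. reflexivity. }
  assert (H1 : down1 A B tau v a * binom_sum phi (n - 1)
    = down1 A B tau v a * sum_f_R0 (w (a - 1)) (S (S n))).
  { destruct (Nat.eq_dec n 0) as [E|E].
    - unfold a; rewrite E; unfold down1; simpl; ring.
    - rewrite Hdown by lia. reflexivity. }
  assert (H2 : down2 A B a * binom_sum phi (n - 2)
    = down2 A B a * sum_f_R0 (w (a - 2)) (S (S n))).
  { destruct (Nat.le_gt_cases 2 n) as [E|E].
    - rewrite Hdown by lia. reflexivity.
    - unfold a; destruct n as [|[|n]]; [| |lia]; unfold down2; simpl; ring. }
  rewrite H1, H2.
  replace (binom_sum phi (n + 2)) with (sum_f_R0 (w (a + 2)) (S (S n))).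
  2:{ unfold w, a. replace (INR n + 2) with (INR (n + 2)) by (rewrite plus_INR; reflexivity).
      apply binom_sum_extend; lia. }
  replace (binom_sum phi (n + 1)) with (sum_f_R0 (w (a + 1)) (S (S n))).
  2:{ unfold w, a. replace (INR n + 1) with (INR (n + 1)) by (rewrite plus_INR; reflexivity).
      apply binom_sum_extend; lia. }
  replace (diag A B tau v a * binom_sum phi n)
    with (diag A B tau v a * sum_f_R0 (w a) (S (S n)))
    by (unfold w, a; rewrite binom_sum_extend by lia; reflexivity).
  (* Summation by parts: the shifts of [phi] given by the hypothesis move onto [signed_binom]. *)
  transitivity (sum_f_R0 (fun j =>
      A * (v + INR j) * (v + INR j - 1) * shift1 (shift1 (signed_binom a)) j * phi j
      + B * (v + INR j) * (INR j + tau) * shift1 (signed_binom a) j * phi j) (S (S n))).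
  - rewrite sum_plus.
    transitivity (sum_f_R0 (fun k =>
        signed_binom a k * (A * (v + INR k + 2) * (v + INR k + 1)) * phi (S (S k))) n
      + sum_f_R0 (fun k =>
        signed_binom a k * (B * (v + INR k + 1) * (INR k + 1 + tau)) * phi (S k)) (S n)).
    (* The second sum has a spare term k = n + 1, zero since C(n, n + 1) = 0; with it both reindexed
       sums end at n + 2. *)
    + rewrite (tech5 _ n). unfold a at 3. rewrite signed_binom_vanish by lia.
      rewrite !Rmult_0_l, Rplus_0_r, <- sum_plus.
      unfold binom_sum. rewrite scal_sum. apply sum_eq; intros k _.
      fold a. rewrite Rmult_assoc, (Rmult_comm (phi k)), Hphi. ring.
    + f_equal.
      * rewrite (sum_shift1 (fun k => signed_binom a k
          * (A * (v + INR k + 2) * (v + INR k + 1))) (fun k => phi (S k))).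
        rewrite (sum_shift1 _ phi).
        apply sum_eq; intros [|[|j]] _; cbn [shift1]; rewrite ?S_INR; ring.
      * rewrite (sum_shift1 _ phi).
        apply sum_eq; intros [|j] _; cbn [shift1]; rewrite ?S_INR; ring.
  - rewrite <- !sum_scal_l, <- !sum_plus. apply sum_eq; intros j _.
    rewrite <- Rmult_plus_distr_r, signed_binom_five_term. unfold w. ring.
Qed.

(** * Recurrences of the Bessel functions *)

(** Since (m + k)! >= 1, the series is dominated by |z/2|^k times the exponential series of
    (z/2)^2. *)
Lemma ex_series_besselI (k : nat) (z : R) :
  ex_series (fun m : nat => (z / 2) ^ (2 * m + k) / (INR (fact m) * INR (fact (m + k)))).
Proof.
  apply (ex_series_le (K := R_AbsRing) (V := R_CompleteNormedModule) _
    (fun m => scal (Rabs (z / 2) ^ k) (((z / 2) ^ 2) ^ m * / INR (fact m)))).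
  - intros m.
    assert (Hm := INR_fact_lt_0 m). assert (Hmk := INR_fact_lt_0 (m + k)).
    change (norm ?a) with (Rabs a). change (scal ?a ?b) with (a * b).
    rewrite <- (pow2_abs (z / 2)).
    rewrite Rabs_div, Rabs_mult, (Rabs_pos_eq (INR (fact m))),
      (Rabs_pos_eq (INR (fact (m + k)))), <- RPow_abs, pow_add, pow_mult
      by (try apply Rmult_integral_contrapositive; lra).
    set (t := Rabs (z / 2)). assert (Ht : 0 <= t) by apply Rabs_pos.
    assert (H1 : 1 <= INR (fact (m + k))).
    { change 1 with (INR 1). apply le_INR. pose proof (lt_O_fact (m + k)). lia. }
    replace (t ^ k * ((t ^ 2) ^ m * / INR (fact m)))
      with ((t ^ 2) ^ m * t ^ k / INR (fact m) * 1) by (field; lra).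
    replace ((t ^ 2) ^ m * t ^ k / (INR (fact m) * INR (fact (m + k))))
      with ((t ^ 2) ^ m * t ^ k / INR (fact m) * / INR (fact (m + k))) by (field; lra).
    apply Rmult_le_compat_l.
    + apply Rdiv_le_0_compat; [|lra].
      apply Rmult_le_pos; apply pow_le; [apply pow_le|]; exact Ht.
    + rewrite <- Rinv_1. apply Rinv_le_contravar; lra.
  - apply (ex_series_scal_l (K := R_AbsRing) (V := R_NormedModule)).
    exists (exp ((z / 2) ^ 2)).
    eapply is_series_ext; [|exact (is_exp_Reals ((z / 2) ^ 2))].
    intros n; cbv beta. rewrite pow_n_pow. reflexivity.
Qed.

(** Termwise: the difference of the order k and order k + 1 terms vanishes at m = 0, and at m + 1 it
    is the m-th term of order k + 2. *)
Lemma besselI_rec (k : nat) (z : R) : z <> 0 ->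
  besselI k z = besselI (S (S k)) z + 2 * (INR k + 1) / z * besselI (S k) z.
Proof.
  intros Hz.
  pose proof (ex_series_besselI k z) as H0.
  pose proof (ex_series_besselI (S k) z) as H1.
  unfold besselI.
  rewrite <- Series_scal_l.
  enough (E : Series (fun m =>
      (z / 2) ^ (2 * m + k) / (INR (fact m) * INR (fact (m + k)))
      - 2 * (INR k + 1) / z *
        ((z / 2) ^ (2 * m + S k) / (INR (fact m) * INR (fact (m + S k)))))
    = Series (fun m =>
      (z / 2) ^ (2 * m + S (S k)) / (INR (fact m) * INR (fact (m + S (S k)))))).
  { rewrite Series_minus in E; [lra|exact H0|].
    apply (ex_series_scal_l (K := R_AbsRing) (V := R_NormedModule)), H1. }
  rewrite Series_incr_1.
  2:{ apply (ex_series_minus (K := R_AbsRing) (V := R_NormedModule)); [exact H0|].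
      apply (ex_series_scal_l (K := R_AbsRing) (V := R_NormedModule)), H1. }
  match goal with |- ?u + _ = _ => replace u with 0 end.
  - rewrite Rplus_0_l. apply Series_ext; intros m.
    replace (2 * S m + S k)%nat with (S (S (S (2 * m + k)))) by lia.
    replace (2 * S m + k)%nat with (S (S (2 * m + k))) by lia.
    replace (2 * m + S (S k))%nat with (S (S (2 * m + k))) by lia.
    replace (S m + S k)%nat with (S (S (m + k))) by lia.
    replace (m + S (S k))%nat with (S (S (m + k))) by lia.
    replace (S m + k)%nat with (S (m + k)) by lia.
    rewrite (fact_simpl m), (fact_simpl (S (m + k))), !mult_INR, !S_INR, plus_INR.
    cbn [pow].
    pose proof (INR_fact_neq_0 m); pose proof (INR_fact_neq_0 (S (m + k))).
    pose proof (pos_INR m); pose proof (pos_INR k).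
    field. repeat split; try assumption; lra.
  - replace (2 * 0 + S k)%nat with (S k) by lia.
    replace (0 + S k)%nat with (S k) by lia.
    replace (2 * 0 + k)%nat with k by lia. replace (0 + k)%nat with k by lia.
    rewrite (fact_simpl k), mult_INR, S_INR. cbn [pow].
    pose proof (INR_fact_neq_0 k); pose proof (INR_fact_neq_0 0).
    pose proof (pos_INR k).
    field. repeat split; try assumption; lra.
Qed.

(** * Improper integrals of exponentially decaying functions *)

Lemma is_RInt_gen_primitive (f F : R -> R) (l : R) :
  (forall b, is_RInt f 0 b (F b)) ->
  filterlim F (Rbar_locally p_infty) (locally l) ->
  is_RInt_gen f (at_point 0) (Rbar_locally p_infty) l.
Proof.
  intros HI HF S HS.
  apply (Filter_prod _ _ _ (fun a => a = 0) (fun b => S (F b))).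
  - reflexivity.
  - exact (HF S HS).
  - intros a b -> Hb. exists (F b). split; [apply HI | exact Hb].
Qed.

Lemma filterlim_exp_decay (F : R -> R) (C : R) :
  (forall t, 0 <= t -> Rabs (F t) <= C * exp (- t)) ->
  filterlim F (Rbar_locally p_infty) (locally 0).
Proof.
  intros HF.
  assert (L : is_lim (fun t => C * exp (- t)) p_infty 0).
  { replace (Finite 0) with (Rbar_mult C (Finite 0)) by (simpl; f_equal; ring).
    apply is_lim_scal_l.
    apply (is_lim_comp exp Ropp p_infty 0 m_infty).
    - exact is_lim_exp_m.
    - apply (is_lim_opp (fun t => t) p_infty p_infty), is_lim_id.
    - exists 0; intros; discriminate. }
  apply (is_lim_le_le_loc (fun t => - (C * exp (- t))) (fun t => C * exp (- t)) F p_infty 0).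
  - exists 0. intros t Ht. apply Rabs_le_between, HF. lra.
  - replace (Finite 0) with (Rbar_opp (Finite 0)) by (simpl; f_equal; ring).
    apply (is_lim_opp _ _ _ L).
  - exact L.
Qed.

(** Cauchy criterion: the integral of f over [s, t] is at most C e^(-s) in absolute value, which
    tends to 0. *)
Lemma ex_RInt_gen_exp_decay (f : R -> R) (C : R) :
  (forall t, continuous f t) ->
  (forall t, 0 <= t -> Rabs (f t) <= C * exp (- t)) ->
  ex_RInt_gen f (at_point 0) (Rbar_locally p_infty).
Proof.
  intros Hc Hb.
  assert (HI : forall a b, ex_RInt f a b).
  { intros a b. apply (ex_RInt_continuous f). intros; apply Hc. }
  assert (HC : 0 <= C).
  { pose proof (Hb 0 (Rle_refl 0)) as H. pose proof (Rabs_pos (f 0)).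
    rewrite Ropp_0, exp_0 in H. lra. }
  assert (Htail : forall s t, 0 <= s <= t -> Rabs (RInt f s t) <= C * exp (- s)).
  { intros s t Hst.
    assert (HE : is_RInt (fun u => C * exp (- u)) s t (- C * exp (- t) - (- C * exp (- s)))).
    { apply (is_RInt_derive (fun u => - C * exp (- u)) (fun u => C * exp (- u))).
      - intros u _. auto_derive; [exact I|ring].
      - intros u _. apply (ex_derive_continuous (V := R_NormedModule)). auto_derive; exact I. }
    apply Rle_trans with (- C * exp (- t) - (- C * exp (- s))).
    - apply (norm_RInt_le f (fun u => C * exp (- u)) s t); try lra.
      + intros u Hu. apply Hb. lra.
      + apply (RInt_correct f), HI.
      + exact HE.
    - pose proof (Rmult_le_pos C (exp (- t)) HC (Rlt_le _ _ (exp_pos _))). lra. }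
  destruct (proj1 (filterlim_locally_cauchy (F := Rbar_locally p_infty) (fun b => RInt f 0 b)))
    as [l Hl].
  - intros eps.
    destruct (proj1 (filterlim_locally _ _)
      (filterlim_exp_decay (fun t => C * exp (- t)) C
        (fun t _ => Req_le _ _ (Rabs_pos_eq _
          (Rmult_le_pos C (exp (- t)) HC (Rlt_le _ _ (exp_pos _)))))) eps) as [M HM].
    (* Beyond M, C e^(-u) is below eps; the maximum with 0 keeps u in the range where the bound on f
       holds. *)
    assert (Hd : forall u v, Rmax M 0 < u -> u <= v ->
      Rabs (RInt f 0 v - RInt f 0 u) < eps).
    { intros u v Hu Huv.
      pose proof (Rmax_l M 0); pose proof (Rmax_r M 0).
      assert (E : RInt f 0 v - RInt f 0 u = RInt f u v).
      { rewrite <- (RInt_Chasles f 0 u v); try apply HI.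
        change (plus ?a ?b) with (a + b). ring. }
      rewrite E.
      apply Rle_lt_trans with (C * exp (- u)); [apply Htail; lra|].
      specialize (HM u ltac:(lra)).
      apply Rle_lt_trans with (2 := HM).
      change (C * exp (- u) <= Rabs (C * exp (- u) - 0)).
      rewrite Rminus_0_r. apply Rle_abs. }
    exists (fun b => Rmax M 0 < b). split; [exists (Rmax M 0); auto|].
    intros u v Hu Hv. change (Rabs (RInt f 0 v - RInt f 0 u) < eps).
    destruct (Rle_dec u v) as [H|H]; [apply Hd; assumption|].
    rewrite Rabs_minus_sym. apply Hd; [assumption|lra].
  - exists l. apply (is_RInt_gen_primitive f (fun b => RInt f 0 b)); [|exact Hl].
    intros b. apply (RInt_correct f), HI.
Qed.

Lemma exp_nondecreasing (s t : R) : s <= t -> exp s <= exp t.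
Proof. intros [H| ->]; [left; apply exp_increasing, H|right; reflexivity]. Qed.

(* Keep only the term (z e^t / 2)^(k+1) / (k+1)! of the series of exp (z e^t / 2). *)
Lemma exp_cosh_decay (z : R) (k : nat) : 0 < z ->
  exists C, forall t, exp (- z * cosh t) * exp (INR k * t) <= C * exp (- t).
Proof.
  (* From e^(-z cosh t) <= e^(-z e^t / 2) <= (k+1)! (2/z)^(k+1) e^(-(k+1) t), multiplied by e^(k
     t). *)
  intros Hz. exists (INR (fact (S k)) * (2 / z) ^ S k). intros t.
  assert (Hf := INR_fact_lt_0 (S k)). assert (Het := exp_pos t).
  assert (Hu : 0 < z * exp t / 2) by (apply Rdiv_lt_0_compat; [apply Rmult_lt_0_compat|]; lra).
  assert (H1 : (z * exp t / 2) ^ S k / INR (fact (S k)) <= exp (z * cosh t)).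
  { apply Rle_trans with (exp (z * exp t / 2)).
    - apply Rle_trans with (2 := exp_ge_taylor (z * exp t / 2) (S k) (Rlt_le _ _ Hu)).
      rewrite tech5, <- (Rplus_0_l (_ / _)) at 1. apply Rplus_le_compat_r, cond_pos_sum.
      intros n. apply Rdiv_le_0_compat; [apply pow_le; lra|apply INR_fact_lt_0].
    - apply exp_nondecreasing. unfold cosh.
      pose proof (Rmult_lt_0_compat z (exp (- t)) Hz (exp_pos _)). lra. }
  replace (- z * cosh t) with (- (z * cosh t)) by ring. rewrite !exp_Ropp.
  assert (Hpow : exp (INR k * t) * exp t = exp t ^ S k).
  { rewrite <- exp_plus, <- Rpower_pow by exact Het. unfold Rpower.
    rewrite ln_exp, S_INR. f_equal. ring. }
  assert (Hc := exp_pos (z * cosh t)).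
  apply (Rmult_le_reg_r (exp t * exp (z * cosh t))); [apply Rmult_lt_0_compat; assumption|].
  replace (/ exp (z * cosh t) * exp (INR k * t) * (exp t * exp (z * cosh t)))
    with (exp t ^ S k) by (rewrite <- Hpow; field; lra).
  replace (INR (fact (S k)) * (2 / z) ^ S k * / exp t * (exp t * exp (z * cosh t)))
    with (INR (fact (S k)) * (2 / z) ^ S k * exp (z * cosh t)) by (field; lra).
  apply Rle_trans with
    (INR (fact (S k)) * (2 / z) ^ S k * ((z * exp t / 2) ^ S k / INR (fact (S k)))).
  - right. replace (z * exp t / 2) with (exp t * (z / 2)) by field.
    rewrite Rpow_mult_distr.
    replace (INR (fact (S k)) * (2 / z) ^ S k * (exp t ^ S k * (z / 2) ^ S k / INR (fact (S k))))
      with (exp t ^ S k * ((2 / z) ^ S k * (z / 2) ^ S k)) by (field; lra).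
    rewrite <- Rpow_mult_distr. replace (2 / z * (z / 2)) with 1 by (field; lra).
    rewrite pow1. ring.
  - apply Rmult_le_compat_l; [|exact H1].
    apply Rmult_le_pos; [lra|apply pow_le, Rlt_le, Rdiv_lt_0_compat; lra].
Qed.

(** For t >= 0 both cosh (k t) and sinh (k t) lie between 0 and e^(k t). The first bound gives
    convergence of the integral of K, the second kills the boundary term at infinity in the
    integration by parts. *)
Lemma besselK_decay (z : R) (k : nat) : 0 < z ->
  exists C, forall t, 0 <= t ->
    Rabs (exp (- z * cosh t) * cosh (INR k * t)) <= C * exp (- t) /\
    Rabs (exp (- z * cosh t) * sinh (INR k * t)) <= C * exp (- t).
Proof.
  intros Hz. destruct (exp_cosh_decay z k Hz) as [C HC]. exists C. intros t Ht.
  specialize (HC t).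
  pose proof (exp_pos (- z * cosh t)) as He.
  assert (Hkt : 0 <= INR k * t) by (apply Rmult_le_pos; [apply pos_INR|exact Ht]).
  assert (Hm : exp (- (INR k * t)) <= exp (INR k * t)) by (apply exp_nondecreasing; lra).
  pose proof (exp_pos (- (INR k * t))).
  rewrite !Rabs_mult, (Rabs_pos_eq (exp _)) by lra.
  unfold cosh at 2; unfold sinh.
  split; apply Rle_trans with (2 := HC); (apply Rmult_le_compat_l; [lra|]);
    rewrite Rabs_pos_eq; lra.
Qed.

Lemma is_RInt_gen_besselK (k : nat) (z : R) : 0 < z ->
  is_RInt_gen (fun t => exp (- z * cosh t) * cosh (INR k * t))
    (at_point 0) (Rbar_locally p_infty) (besselK (INR k) z).
Proof.
  intros Hz. apply (RInt_gen_correct (V := R_CompleteNormedModule)).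
  destruct (besselK_decay z k Hz) as [C HC].
  apply ex_RInt_gen_exp_decay with C; [|apply HC].
  intros t. apply (ex_derive_continuous (V := R_NormedModule)).
  unfold cosh. auto_derive. exact I.
Qed.

(* Integration by parts: (e^(-z cosh t) sinh (k t))' integrates to 0, and
   2 sinh (k t) sinh t = cosh ((k + 1) t) - cosh ((k - 1) t). *)
Lemma besselK_rec (k : nat) (z : R) : 0 < z ->
  besselK (INR (S (S k))) z =
  besselK (INR k) z + 2 * (INR k + 1) / z * besselK (INR (S k)) z.
Proof.
  intros Hz.
  destruct (besselK_decay z (S k) Hz) as [C HC].
  set (F := fun t => exp (- z * cosh t) * sinh (INR (S k) * t)).
  set (f := fun m t => exp (- z * cosh t) * cosh (INR m * t)).
  assert (H0 : is_RInt_gen (fun t => - (z / 2) * (f (S (S k)) t - f k t) + INR (S k) * f (S k) t)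
    (at_point 0) (Rbar_locally p_infty) 0).
  { apply is_RInt_gen_primitive with F.
    - intros b.
      (* The boundary term at 0 vanishes because sinh 0 = 0. *)
      replace (F b) with (minus (F b) (F 0)).
      2:{ unfold F. rewrite Rmult_0_r, sinh_0, Rmult_0_r. apply Rminus_0_r. }
      apply (is_RInt_derive F).
      + intros t _. unfold F, f, cosh, sinh.
        (* With a = k + 1 the orders k + 2 and k are a + 1 and a - 1, so the exponentials split into
           products and the check becomes algebraic. *)
        rewrite (S_INR (S k)). replace (INR k) with (INR (S k) - 1) by (rewrite S_INR; ring).
        generalize (INR (S k)); intros a.
        auto_derive; [exact I|].
        replace ((a + 1) * t) with (a * t + t) by ring.
        replace ((a - 1) * t) with (a * t + - t) by ring.
        rewrite !Ropp_plus_distr, Ropp_involutive, !exp_plus. unfold Rdiv. field.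
      + intros t _. apply (ex_derive_continuous (V := R_NormedModule)).
        unfold f, cosh. auto_derive. exact I.
    - apply filterlim_exp_decay with C. apply HC. }
  assert (Hm : forall m, is_RInt_gen (f m) (at_point 0) (Rbar_locally p_infty)
    (besselK (INR m) z)) by (intros m; apply is_RInt_gen_besselK, Hz).
  (* The same integral, computed by linearity from the three Bessel integrals; uniqueness equates it
     to 0. *)
  assert (H1 := is_RInt_gen_plus _ _ _ _
    (is_RInt_gen_scal _ (- (z / 2)) _ (is_RInt_gen_minus _ _ _ _ (Hm (S (S k))) (Hm k)))
    (is_RInt_gen_scal _ (INR (S k)) _ (Hm (S k)))).
  assert (E := eq_trans (eq_sym (is_RInt_gen_unique _ _ H1)) (is_RInt_gen_unique _ _ H0)).
  change (- (z / 2) * (besselK (INR (S (S k))) z - besselK (INR k) z)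
    + INR (S k) * besselK (INR (S k)) z = 0) in E.
  apply (Rmult_eq_reg_l (z / 2)); [|lra].
  transitivity (z / 2 * besselK (INR k) z + INR (S k) * besselK (INR (S k)) z); [lra|].
  rewrite <- S_INR. field. lra.
Qed.

(** * Five-term recurrences of P and Q *)

Lemma Rpower_half_INR (x : R) (k : nat) : 0 < x -> Rpower x (INR k / 2) = sqrt x ^ k.
Proof.
  intros Hx. replace (INR k / 2) with (/ 2 * INR k) by field.
  rewrite <- Rpower_mult, Rpower_sqrt by exact Hx.
  apply Rpower_pow, sqrt_lt_R0, Hx.
Qed.

Lemma Rpower_INR_plus_half (c : R) (k : nat) : 0 < c ->
  Rpower c (INR k + 1 / 2) = c ^ k * sqrt c.
Proof.
  intros Hc. replace (1 / 2) with (/ 2) by field.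
  rewrite Rpower_plus, Rpower_pow, Rpower_sqrt by exact Hc. reflexivity.
Qed.

Section BesselFamilies.

Variables (alpha delta : R) (nu : nat).
Hypotheses (Hdelta : 0 < delta) (Halpha : delta < alpha).

Let c := alpha ^ 2 - delta ^ 2.

Let Hc : 0 < c.
Proof. unfold c. nra. Qed.

(** In [phi_P] and [phi_Q], the half-integer power of c is split: its integer power stays here,
    while sqrt c joins the factors depending on n only in [norm_P] and [norm_Q]. *)
Definition phi_P (x : R) (k : nat) : R :=
  (c / delta) ^ k / INR (fact (nu + k)) * (sqrt x ^ k * besselI k (2 * delta * sqrt x)).

Definition phi_Q (y : R) (l : nat) : R :=
  c ^ (l + nu) / alpha ^ (l + nu) / INR (fact (nu + l))
  * (sqrt y ^ (l + nu) * besselK (INR (l + nu)) (2 * alpha * sqrt y)).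

Definition norm_P (n : nat) : R := (-1) ^ n * INR (fact (nu + n)) * INR (fact n) * sqrt c.
Definition norm_Q (n : nat) : R := (-1) ^ n * (2 / INR (fact n) ^ 2) * sqrt c.

Lemma P_binom_sum (n : nat) (x : R) : 0 < x ->
  P alpha delta nu n x = norm_P n * binom_sum (phi_P x) n.
Proof.
  intros Hx. unfold P, norm_P, binom_sum.
  rewrite (Rmult_assoc _ (sqrt c)), <- (sum_scal_l _ (sqrt c)). f_equal.
  apply sum_eq; intros k _.
  fold c. rewrite Rpower_half_INR, Rpower_INR_plus_half by assumption.
  unfold signed_binom, phi_P, Rdiv. rewrite Rpow_mult_distr, pow_inv, Rinv_mult. ring.
Qed.

Lemma Q_binom_sum (n : nat) (y : R) : 0 < y ->
  Q alpha delta nu n y = norm_Q n * binom_sum (phi_Q y) n.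
Proof.
  intros Hy. unfold Q, norm_Q, binom_sum.
  rewrite (Rmult_assoc _ (sqrt c)), <- (sum_scal_l _ (sqrt c)). f_equal.
  apply sum_eq; intros k _.
  fold c. rewrite <- plus_INR, Rpower_half_INR, Rpower_INR_plus_half by assumption.
  unfold signed_binom, phi_Q, Rdiv. rewrite Rinv_mult. ring.
Qed.

(** [besselI_rec] at z = 2 delta sqrt x, where 2 (k + 1) / z = (k + 1) / (delta sqrt x); the factor
    x = (sqrt x)^2 supplies the missing powers. *)
Lemma phi_P_rec (x : R) (k : nat) : 0 < x ->
  x * phi_P x k =
  delta ^ 2 / c ^ 2 * (INR nu + INR k + 2) * (INR nu + INR k + 1) * phi_P x (S (S k))
  + 1 / c * (INR nu + INR k + 1) * (INR k + 1 + 0) * phi_P x (S k).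
Proof.
  intros Hx. pose proof (sqrt_lt_R0 x Hx) as Hs.
  assert (Hz : 2 * delta * sqrt x <> 0) by (apply Rgt_not_eq; nra).
  unfold phi_P at 1. rewrite (besselI_rec k) by exact Hz.
  unfold phi_P.
  replace (nu + S (S k))%nat with (S (S (nu + k))) by lia.
  replace (nu + S k)%nat with (S (nu + k)) by lia.
  rewrite (fact_simpl (S (nu + k))), (fact_simpl (nu + k)), !mult_INR, !S_INR, plus_INR.
  rewrite <- (sqrt_sqrt x) at 1 by lra.
  cbn [pow]. generalize ((c / delta) ^ k); intros T.
  pose proof (INR_fact_neq_0 (nu + k)). pose proof (pos_INR nu). pose proof (pos_INR k).
  field. repeat split; try assumption; try lra.
Qed.

(** Solving [besselK_rec] for the lowest order gives a minus sign, hence B = -1/c; the order is l +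
    nu, hence tau = nu. *)
Lemma phi_Q_rec (y : R) (l : nat) : 0 < y ->
  y * phi_Q y l =
  alpha ^ 2 / c ^ 2 * (INR nu + INR l + 2) * (INR nu + INR l + 1) * phi_Q y (S (S l))
  + - (1 / c) * (INR nu + INR l + 1) * (INR l + 1 + INR nu) * phi_Q y (S l).
Proof.
  intros Hy. pose proof (sqrt_lt_R0 y Hy) as Hs.
  assert (Hz : 0 < 2 * alpha * sqrt y) by nra.
  unfold phi_Q.
  change (S (S l) + nu)%nat with (S (S (l + nu))). change (S l + nu)%nat with (S (l + nu)).
  rewrite (besselK_rec (l + nu)) by exact Hz.
  replace (nu + S (S l))%nat with (S (S (nu + l))) by lia.
  replace (nu + S l)%nat with (S (nu + l)) by lia.
  rewrite (fact_simpl (S (nu + l))), (fact_simpl (nu + l)), !mult_INR, !(S_INR (S (nu + l))),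
    !(S_INR (nu + l)), !plus_INR.
  rewrite <- (sqrt_sqrt y) at 1 by lra.
  cbn [pow].
  pose proof (INR_fact_neq_0 (nu + l)). pose proof (pos_INR nu). pose proof (pos_INR l).
  assert (alpha ^ (l + nu) <> 0) by (apply pow_nonzero; lra).
  field. repeat split; try assumption; try lra.
Qed.

(** The diagonal coefficient, common to both recurrences; it is absent from the final formula
    because it cancels in (x - y) P_n(x) Q_n(y). *)
Definition a_0 (n : nat) : R := diag (delta ^ 2 / c ^ 2) (1 / c) 0 (INR nu) (INR n).

(** The coefficients of [binom_sum_five_term] get multiplied by ratios of [norm_P]. Truncated
    indices are harmless: [a_m1] vanishes at n = 0 and [a_m2] at n = 0, 1. *)
Lemma P_five_term (n : nat) (x : R) : 0 < x ->
  x * P alpha delta nu n x =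
  a_2 alpha delta n * P alpha delta nu (n + 2) x
  + a_1 alpha delta nu n * P alpha delta nu (n + 1) x
  + a_0 n * P alpha delta nu n x
  + a_m1 alpha delta nu n * P alpha delta nu (n - 1) x
  + a_m2 alpha delta nu n * P alpha delta nu (n - 2) x.
Proof.
  intros Hx. rewrite !P_binom_sum by exact Hx.
  replace (x * (norm_P n * binom_sum (phi_P x) n))
    with (norm_P n * (x * binom_sum (phi_P x) n)) by ring.
  rewrite (binom_sum_five_term x (delta ^ 2 / c ^ 2) (1 / c) 0 nu n)
    by (intros; apply phi_P_rec, Hx).
  assert (E2 : norm_P n * up2 (delta ^ 2 / c ^ 2) (INR nu) (INR n)
    = a_2 alpha delta n * norm_P (n + 2)).
  { unfold norm_P, a_2, up2. fold c.
    replace (nu + (n + 2))%nat with (S (S (nu + n))) by lia.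
    replace (n + 2)%nat with (S (S n)) by lia.
    rewrite !fact_simpl, !mult_INR, !S_INR, plus_INR. cbn [pow].
    pose proof (pos_INR n). field. repeat split; lra. }
  assert (E1 : norm_P n * up1 (delta ^ 2 / c ^ 2) (1 / c) 0 (INR nu) (INR n)
    = a_1 alpha delta nu n * norm_P (n + 1)).
  { unfold norm_P, a_1, up1. fold c.
    replace (nu + (n + 1))%nat with (S (nu + n)) by lia.
    replace (n + 1)%nat with (S n) by lia.
    rewrite !fact_simpl, !mult_INR, !S_INR, plus_INR. cbn [pow].
    pose proof (pos_INR n). field. repeat split; lra. }
  assert (F1 : norm_P n * down1 (delta ^ 2 / c ^ 2) (1 / c) 0 (INR nu) (INR n)
    = a_m1 alpha delta nu n * norm_P (n - 1)).
  { unfold norm_P, a_m1, down1. fold c.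
    destruct n as [|n]; [cbn [INR]; unfold Rdiv; ring|].
    replace (nu + S n)%nat with (S (nu + n)) by lia.
    replace (S n - 1)%nat with n by lia.
    rewrite !fact_simpl, !mult_INR, !S_INR, plus_INR. cbn [pow].
    field. lra. }
  assert (F2 : norm_P n * down2 (delta ^ 2 / c ^ 2) (1 / c) (INR n)
    = a_m2 alpha delta nu n * norm_P (n - 2)).
  { unfold norm_P, a_m2, down2.
    (* Here A + B = delta^2/c^2 + 1/c = alpha^2/c^2, the source of alpha in [a_m2]. *)
    replace (alpha ^ 2) with (c + delta ^ 2) by (unfold c; ring).
    replace (c + delta ^ 2 - delta ^ 2) with c by ring.
    destruct n as [|[|n]]; [cbn [INR]; unfold Rdiv; ring|cbn [INR]; unfold Rdiv; ring|].
    replace (nu + S (S n))%nat with (S (S (nu + n))) by lia.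
    replace (S (S n) - 2)%nat with n by lia.
    rewrite !fact_simpl, !mult_INR, !S_INR, plus_INR. cbn [pow].
    field. lra. }
  rewrite !Rmult_plus_distr_l, <- !Rmult_assoc, E2, E1, F1, F2. unfold a_0. ring.
Qed.

(* [a_2] at index n - 2 and [a_1] at index n - 1 are junk for n <= 1 and n = 0. *)
Lemma Q_five_term (n : nat) (y : R) : 0 < y ->
  y * Q alpha delta nu n y =
  a_m2 alpha delta nu (n + 2) * Q alpha delta nu (n + 2) y
  + a_m1 alpha delta nu (n + 1) * Q alpha delta nu (n + 1) y
  + a_0 n * Q alpha delta nu n y
  + (if (n <? 1)%nat then 0 else a_1 alpha delta nu (n - 1) * Q alpha delta nu (n - 1) y)
  + (if (n <? 2)%nat then 0 else a_2 alpha delta (n - 2) * Q alpha delta nu (n - 2) y).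
Proof.
  intros Hy. rewrite !Q_binom_sum by exact Hy.
  replace (y * (norm_Q n * binom_sum (phi_Q y) n))
    with (norm_Q n * (y * binom_sum (phi_Q y) n)) by ring.
  rewrite (binom_sum_five_term y (alpha ^ 2 / c ^ 2) (- (1 / c)) (INR nu) nu n)
    by (intros; apply phi_Q_rec, Hy).
  (* For Q, A + B = alpha^2/c^2 - 1/c = delta^2/c^2, so alpha and delta trade places between the
     extreme coefficients, as transposition requires. *)
  assert (Ha : alpha ^ 2 = c + delta ^ 2) by (unfold c; ring).
  assert (E2 : norm_Q n * up2 (alpha ^ 2 / c ^ 2) (INR nu) (INR n)
    = a_m2 alpha delta nu (n + 2) * norm_Q (n + 2)).
  { unfold norm_Q, a_m2, up2. fold c.
    replace (n + 2)%nat with (S (S n)) by lia.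
    rewrite !fact_simpl, !mult_INR, !S_INR. cbn [pow].
    pose proof (pos_INR n). pose proof (INR_fact_neq_0 n). field. repeat split; lra. }
  assert (E1 : norm_Q n * up1 (alpha ^ 2 / c ^ 2) (- (1 / c)) (INR nu) (INR nu) (INR n)
    = a_m1 alpha delta nu (n + 1) * norm_Q (n + 1)).
  { unfold norm_Q, a_m1, up1. fold c. rewrite Ha.
    replace (n + 1)%nat with (S n) by lia.
    rewrite !fact_simpl, !mult_INR, !S_INR. cbn [pow].
    pose proof (pos_INR n). pose proof (INR_fact_neq_0 n). field. repeat split; lra. }
  assert (E0 : diag (alpha ^ 2 / c ^ 2) (- (1 / c)) (INR nu) (INR nu) (INR n) = a_0 n).
  { unfold a_0, diag. rewrite Ha. field. lra. }
  assert (F1 : norm_Q n * down1 (alpha ^ 2 / c ^ 2) (- (1 / c)) (INR nu) (INR nu) (INR n)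
    = if (n <? 1)%nat then 0 else a_1 alpha delta nu (n - 1) * norm_Q (n - 1)).
  { unfold norm_Q, a_1, down1. fold c. rewrite Ha.
    destruct n as [|n]; [cbn [INR Nat.ltb Nat.leb]; unfold Rdiv; ring|].
    change (S n <? 1)%nat with false. cbv iota.
    replace (S n - 1)%nat with n by lia.
    rewrite !fact_simpl, !mult_INR, !S_INR. cbn [pow].
    pose proof (pos_INR n). pose proof (INR_fact_neq_0 n). field. repeat split; lra. }
  assert (F2 : norm_Q n * down2 (alpha ^ 2 / c ^ 2) (- (1 / c)) (INR n)
    = if (n <? 2)%nat then 0 else a_2 alpha delta (n - 2) * norm_Q (n - 2)).
  { unfold norm_Q, a_2, down2. fold c. rewrite Ha.
    destruct n as [|[|n]]; [cbn [INR Nat.ltb Nat.leb]; unfold Rdiv; ring|cbn [INR Nat.ltb Nat.leb]; unfold Rdiv; ring|].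
    change (S (S n) <? 2)%nat with false. cbv iota.
    replace (S (S n) - 2)%nat with n by lia.
    rewrite !fact_simpl, !mult_INR, !S_INR. cbn [pow].
    pose proof (pos_INR n). pose proof (INR_fact_neq_0 n). field. repeat split; lra. }
  rewrite !Rmult_plus_distr_l, <- !Rmult_assoc, E2, E1, E0, F1, F2.
  destruct (n <? 1)%nat, (n <? 2)%nat; ring.
Qed.

(** With N = m + 2, the terms a_{i,n} P_{n+i} Q_n whose indices n and n + i are both below N cancel.
    Those with n < N <= n + i remain with sign +, those with n + i < N <= n with sign -. *)
Lemma christoffel_darboux (m : nat) (x y : R) : 0 < x -> 0 < y ->
  (x - y) * kernelK alpha delta nu (m + 2) x y =
  a_1 alpha delta nu (m + 1) * P alpha delta nu (m + 2) x * Q alpha delta nu (m + 1) y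
  + a_2 alpha delta m * P alpha delta nu (m + 2) x * Q alpha delta nu m y
  + a_2 alpha delta (m + 1) * P alpha delta nu (m + 3) x * Q alpha delta nu (m + 1) y
  - (a_m2 alpha delta nu (m + 2) * P alpha delta nu m x * Q alpha delta nu (m + 2) y
     + a_m2 alpha delta nu (m + 3) * P alpha delta nu (m + 1) x * Q alpha delta nu (m + 3) y
     + a_m1 alpha delta nu (m + 2) * P alpha delta nu (m + 1) x * Q alpha delta nu (m + 2) y).
Proof.
  intros Hx Hy.
  assert (Hsplit : forall p q, (x - y) * (p * q) = x * p * q - p * (y * q))
    by (intros; ring).
  induction m as [|m IH]; unfold kernelK in *.
  - cbn [Nat.add Nat.sub sum_f_R0].
    rewrite Rmult_plus_distr_l, !Hsplit, !P_five_term, !Q_five_term by assumption.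
    cbn [Nat.add Nat.sub Nat.ltb Nat.leb].
    (* These three zeros remove the terms of the P recurrences at n = 0, 1 whose index was
       truncated. *)
    replace (a_m1 alpha delta nu 0) with 0 by (unfold a_m1; simpl; unfold Rdiv; ring).
    replace (a_m2 alpha delta nu 0) with 0 by (unfold a_m2; simpl; unfold Rdiv; ring).
    replace (a_m2 alpha delta nu 1) with 0 by (unfold a_m2; simpl; unfold Rdiv; ring).
    ring.
  - replace (S m + 2 - 1)%nat with (S (m + 2 - 1)) by lia.
    rewrite tech5, Rmult_plus_distr_l, IH, Hsplit.
    replace (S (m + 2 - 1)) with (m + 2)%nat by lia.
    rewrite P_five_term, Q_five_term by assumption.
    replace (m + 2 <? 1)%nat with false by (symmetry; apply Nat.ltb_ge; lia).
    replace (m + 2 <? 2)%nat with false by (symmetry; apply Nat.ltb_ge; lia).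
    replace (m + 2 - 1)%nat with (m + 1)%nat by lia.
    replace (m + 2 - 2)%nat with m by lia.
    replace (m + 2 + 1)%nat with (m + 3)%nat by lia.
    replace (m + 2 + 2)%nat with (m + 4)%nat by lia.
    replace (S m + 1)%nat with (m + 2)%nat by lia.
    replace (S m + 2)%nat with (m + 3)%nat by lia.
    replace (S m + 3)%nat with (m + 4)%nat by lia.
    replace (S m) with (m + 1)%nat by lia.
    ring.
Qed.

End BesselFamilies.

Theorem theorem3p6 :
  forall (mu alpha delta : R) (N nu : nat) (x y : R),
    0 < mu < 1 ->
    alpha = (1 + mu) / (2 * mu) ->
    delta = (1 - mu) / (2 * mu) ->
    (2 <= N)%nat ->
    0 < x -> 0 < y -> x <> y ->
    kernelK alpha delta nu N x y =
      - ((a_m2 alpha delta nu N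
            * P alpha delta nu (N - 2) x * Q alpha delta nu N y
          + a_m2 alpha delta nu (N + 1)
            * P alpha delta nu (N - 1) x * Q alpha delta nu (N + 1) y
          + a_m1 alpha delta nu N
            * P alpha delta nu (N - 1) x * Q alpha delta nu N y)
         / (x - y))
      + (a_1 alpha delta nu (N - 1)
            * P alpha delta nu N x * Q alpha delta nu (N - 1) y
         + a_2 alpha delta (N - 2)
            * P alpha delta nu N x * Q alpha delta nu (N - 2) y
         + a_2 alpha delta (N - 1)
            * P alpha delta nu (N + 1) x * Q alpha delta nu (N - 1) y)
        / (x - y).
Proof.
  intros mu alpha delta N nu x y Hmu Halpha Hdelta HN Hx Hy Hxy.
  assert (Hd : 0 < delta) by (rewrite Hdelta; apply Rdiv_lt_0_compat; lra).
  assert (Hda : delta < alpha).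
  (* alpha - delta = 2 mu / (2 mu) = 1. *)
  { replace alpha with (delta + 1) by (rewrite Halpha, Hdelta; field; lra). lra. }
  clear Halpha Hdelta.
  destruct (Nat.le_exists_sub 2 N HN) as [m [-> _]].
  replace (m + 2 - 1)%nat with (m + 1)%nat by lia.
  replace (m + 2 - 2)%nat with m by lia.
  replace (m + 2 + 1)%nat with (m + 3)%nat by lia.
  apply (Rmult_eq_reg_l (x - y)); [|lra].
  rewrite christoffel_darboux by assumption.
  field. lra.
Qed.
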